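(* Let $d\ge 1$ and let $S\subset\mathbb{R}^d$ be a symmetric-matrix uniqueness set. If $P,Q$ are elliptical distributions on $\mathbb{R}^d$ such that $P_{\langle x\rangle}=Q_{\langle x\rangle}$ for all $x\in S$, then $P=Q$.
   Context: Elements of $\mathbb{R}^d$ are column vectors. A Borel probability measure $P$ on $\mathbb{R}^d$ is an elliptical distribution if its characteristic function $\phi_P(\xi)=\int e^{ix\cdot\xi}\,dP(x)$ has the form $\phi_P(\xi)=e^{i\mu\cdot\xi}\psi(\xi^\top\Sigma\xi)$ for all $\xi\in\mathbb{R}^d$, where $\Sigma$ is a real (symmetric) positive semi-definite $d\times d$ matrix, $\mu\in\mathbb{R}^d$, and $\psi:[0,\infty)\to\mathbb{C}$ is continuous ($\mu,\Sigma,\psi$ may depend on $P$). A set $S\subset\mathbb{R}^d$ is a symmetric-matrix uniqueness set (sm-uniqueness set) if the only real symmetric $d\times d$ matrix $A$ satisfying $x^\top Ax=0$ for all $x\in S$ is the zero matrix. For a vector subspace $H\subset\mathbb{R}^d$ with orthogonal projection $\pi_H:\mathbb{R}^d\to H$, $P_H$ denotes the Borel probability measure on $H$ given by $P_H(B)=P(\pi_H^{-1}(B))$. For $x\in\mathbb{R}^d$, $\langle x\rangle$ denotes the linear span of $x$ (one-dimensional if $x\neq0$, and $\{0\}$ if $x=0$). *)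

(* Defs.v *)
From HB Require Import structures.
From mathcomp Require Import all_boot all_order all_algebra.
From mathcomp Require Import complex.
From mathcomp Require Import all_classical all_reals all_analysis.
Import numFieldNormedType.Exports.
Import Order.TTheory GRing.Theory Num.Theory.
Set Implicit Arguments. Unset Strict Implicit. Unset Printing Implicit Defensive.
Local Open Scope classical_set_scope.
Local Open Scope ring_scope.

Definition dotv (R : realType) (d : nat) (x y : 'cV[R]_d) : R := (x^T *m y) 0 0.

Definition quadf (R : realType) (d : nat) (A : 'M[R]_d) (x : 'cV[R]_d) : R :=
  (x^T *m A *m x) 0 0.

Definition is_psd (R : realType) (d : nat) (A : 'M[R]_d) : Prop :=
  A^T = A /\ forall x : 'cV[R]_d, 0 <= quadf A x.

Definition sm_uniqueness_set (R : realType) (d : nat) (S : set 'cV[R]_d) : Prop :=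
  forall A : 'M[R]_d, A^T = A -> (forall x, S x -> quadf A x = 0) -> A = 0.

Definition borelVec (R : realType) (d : nat) := g_sigma_algebraType (@open 'cV[R]_d).

HB.instance Definition _ (R : realType) (d : nat) (H : {vspace 'cV[R]_d}) :=
  isPointed.Build (subvs_of H) 0.

(* [H] carries the subspace topology, the initial one for the inclusion
   [vsval : H -> 'cV[R]_d]. *)
Definition borelSubspace (R : realType) (d : nat) (H : {vspace 'cV[R]_d}) :=
  g_sigma_algebraType (@open (initial_topology (@vsval R 'cV[R]_d H))).

Definition is_orth_proj (R : realType) (d : nat) (H : {vspace 'cV[R]_d})
    (v : 'cV[R]_d) (u : subvs_of H) : Prop :=
  forall h, h \in H -> dotv h (v - vsval u) = 0.

(* The default value [0] is never used, see [orth_projP]. *)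
Definition orth_proj (R : realType) (d : nat) (H : {vspace 'cV[R]_d})
    (v : borelVec R d) : borelSubspace H :=
  xget (0 : subvs_of H) [set u | is_orth_proj v u].

Section orth_proj_theory.
Variables (R : realType) (d : nat).
Implicit Types (H : {vspace 'cV[R]_d}) (x y v : 'cV[R]_d).

Lemma dotvE x y : dotv x y = \sum_i x i 0 * y i 0.
Proof. by rewrite /dotv mxE; apply: eq_bigr => i _; rewrite mxE. Qed.

Lemma dotv_self_eq0 x : dotv x x = 0 -> x = 0.
Proof.
rewrite dotvE => /psumr_eq0P x0; apply/colP => i; rewrite mxE.
have /eqP := x0 (fun i _ => sqr_ge0 (x i 0)) i isT.
by rewrite mulf_eq0 orbb => /eqP.
Qed.

Lemma is_orth_proj_uniq H v (u w : subvs_of H) :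
  is_orth_proj v u -> is_orth_proj v w -> u = w.
Proof.
move=> hu hw; apply: val_inj; apply/eqP; rewrite -subr_eq0; apply/eqP.
apply: dotv_self_eq0.
have hH : vsval u - vsval w \in H by rewrite rpredB // subvsP.
have := hw _ hH; have := hu _ hH; rewrite /dotv => e1 e2.
have -> : vsval u - vsval w = (v - vsval w) - (v - vsval u).
  by rewrite opprB [RHS]addrC addrA subrK.
set t := (X in X^T *m _); rewrite mulmxBr mxE [X in _ + X]mxE.
have -> : t = vsval u - vsval w by rewrite /t opprB [LHS]addrC addrA subrK.
by rewrite e1 e2 subrr.
Qed.

Lemma orth_proj_mx H : exists M : 'M[R]_d, forall v, M *m v \in H /\
  forall h, h \in H -> dotv h (v - M *m v) = 0.
Proof.
pose b := vbasis H.
pose U : 'M[R]_(\dim H, d) := \matrix_(i, j) b`_i j 0.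
have UE (c : 'rV[R]_(\dim H)) : (c *m U)^T = \sum_i c 0 i *: b`_i.
  apply/colP => j; rewrite !mxE summxE; apply: eq_bigr => i _.
  by rewrite !mxE.
have Gu : U *m U^T \in unitmx.
  rewrite -row_free_unit -kermx_eq0; apply/eqP/row_matrixP => k; rewrite row0.
  set c := row k _.
  have cG : c *m (U *m U^T) = 0.
    by rewrite /c -row_mul mulmx_ker row0.
  have : (c *m U)^T = 0.
    apply: dotv_self_eq0; rewrite /dotv trmxK trmx_mul mulmxA -(mulmxA c).
    by rewrite cG mul0mx mxE.
  rewrite UE => /(@freeP _ _ _ b (basis_free (vbasisP H))) c0.
  by apply/rowP => i; rewrite c0 mxE.
exists (U^T *m invmx (U *m U^T) *m U) => v; split.
  rewrite -!mulmxA; set c := invmx _ *m _.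
  rewrite -[c]trmxK -trmx_mul UE; apply: memv_suml => i _.
  by rewrite memvZ // vbasis_mem // mem_nth // size_tuple.
move=> h /(coord_vbasis) ->.
have -> : \sum_i coord b i h *: b`_i = ((\row_i coord b i h) *m U)^T.
  by rewrite UE; apply: eq_bigr => i _; rewrite mxE.
rewrite /dotv trmxK mulmxBr -!mulmxA (mulmxA U).
by rewrite (mulmxA (U *m U^T)) mulmxV // mul1mx subrr mxE.
Qed.

Lemma orth_projP H v : is_orth_proj v (orth_proj H v).
Proof.
have [M /(_ v)[MH Mo]] := orth_proj_mx H.
apply: (xgetPex (0 : subvs_of H) (P := [set u | is_orth_proj v u])).
by exists (Subvs MH) => h hH /=; exact: Mo.
Qed.

Lemma continuous_mulmx (M : 'M[R]_d) : continuous (fun v : 'cV[R]_d => M *m v).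
Proof.
move=> v A [P MP PA].
have H i j : \forall w \near v, P i j ((M *m w) i j).
  suff : continuous (fun w : 'cV[R]_d => (M *m w) i j).
    by move/(_ v); apply; exact: MP.
  have -> : (fun w : 'cV[R]_d => (M *m w) i j) =
            (fun w : 'cV[R]_d => \sum_k M i k * w k j).
    by apply/funext => w; rewrite mxE.
  elim: (index_enum _) => [|k r IH].
    under eq_fun do rewrite big_nil.
    exact: cst_continuous.
  under eq_fun do rewrite big_cons.
  have cX (w : 'cV[R]_d) :
      {for w, continuous (fun w : 'cV[R]_d => M i k * w k j)}.
    by apply: continuousM; [exact: cst_continuous|exact: coord_continuous].
  move=> w; exact: (continuousD (cX w) (IH w)).
have : \forall w \near v, forall i j, P i j ((M *m w) i j).
  apply: (@filter_forall _ _ (fun i w => forall j, P i j ((M *m w) i j))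
    (nbhs v) (nbhs_filter v)) => i.
  exact: (@filter_forall _ _ (fun j w => P i j ((M *m w) i j))
    (nbhs v) (nbhs_filter v) (H i)).
apply: (@filterS _ (nbhs v) (nbhs_filter v)) => w; exact: PA.
Qed.

Lemma measurable_orth_proj H : measurable_fun setT (@orth_proj R d H).
Proof.
have [M MP] := orth_proj_mx H.
apply: measurability => //= _ [_ [U Uo <-] <-]; rewrite setTI.
apply: sub_sigma_algebra.
have -> : orth_proj H @^-1` (vsval @^-1` U) = (fun v => M *m v) @^-1` U.
  apply/funext => v; congr U; have [MH Mo] := MP v.
  have /(congr1 vsval) // : orth_proj H v = Subvs MH :> subvs_of H.
  apply: is_orth_proj_uniq; first exact: orth_projP.
  by move=> h hH /=; exact: Mo.
by apply: open_comp => // v _; exact: continuous_mulmx.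
Qed.

End orth_proj_theory.

HB.instance Definition _ (R : realType) (d : nat) (H : {vspace 'cV[R]_d}) :=
  isMeasurableFun.Build _ _ _ _ (@orth_proj R d H) (@measurable_orth_proj R d H).

Definition proj_prob (R : realType) (d : nat) (P : probability (borelVec R d) R)
    (H : {vspace 'cV[R]_d}) : probability (borelSubspace H) R :=
  distribution P (@orth_proj R d H).

Definition cexpi (R : realType) (t : R) : R[i] := Complex (cos t) (sin t).

(* The library only integrates real-valued functions. *)
Definition Cintegral (d : measure_display) (T : measurableType d) (R : realType)
    (mu : {measure set T -> \bar R}) (f : T -> R[i]) : R[i] :=
  Complex (\int[mu]_x complex.Re (f x)) (\int[mu]_x complex.Im (f x)).

Definition charfun (R : realType) (d : nat) (P : probability (borelVec R d) R)
    (xi : 'cV[R]_d) : R[i] :=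
  Cintegral P (fun x : borelVec R d => cexpi (dotv x xi)).

(* [psi] is a total function but only its restriction to [0, +oo[ matters;
   [R[i]^o] is [R[i]] with the topology of the complex modulus. *)
Definition elliptical (R : realType) (d : nat)
    (P : probability (borelVec R d) R) : Prop :=
  exists (mu : 'cV[R]_d) (Sigma : 'M[R]_d) (psi : R -> R[i]^o),
    [/\ is_psd Sigma,
        {within `[0, +oo[, continuous psi} &
        forall xi : 'cV[R]_d,
          charfun P xi = cexpi (dotv mu xi) * psi (quadf Sigma xi)].

(* Main.v *)
Require Import Defs.
From HB Require Import structures.
From mathcomp Require Import all_boot all_order all_algebra.
From mathcomp Require Import complex.
From mathcomp Require Import all_classical all_reals all_analysis.
From mathcomp Require Import measurable_realfun lra ring.
Import numFieldNormedType.Exports.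
Import Order.TTheory GRing.Theory Num.Theory.
Set Implicit Arguments. Unset Strict Implicit. Unset Printing Implicit Defensive.
Local Open Scope classical_set_scope.
Local Open Scope ring_scope.

(** The projection of P on the line through x determines the characteristic
    function of P along that line, because the dot product of y with t x only
    depends on the projection of y ([charfun_proj_prob]). So for x in S and
    all real t,
      exp(i t mu.x) p(t^2 x'Ax) = exp(i t nu.x) q(t^2 x'Bx),
    where P has location mu, matrix A and profile p, and Q has nu, B and q.
    Three facts then give the equality of both characteristic functions on the
    whole space.

    - The profiles may be taken real, since the characteristic function at
      minus xi is conjugate to the one at xi, and they tend to 1 at 0
      ([elliptical_real]). For small t the quotient of both sides shows that
      sin(t (mu - nu).x) = 0, so (mu - nu).x = 0 on S ([phase_eq0]). The
      quadratic form of the rank one matrix (mu - nu)(mu - nu)' vanishes on S,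
      so mu = nu ([dotv_ext]).

    - A profile with p(s a) = p(s b) for all s >= 0, where a < b, is constant:
      p(u) = p(u (a/b)^n), which tends to 1 ([scaling_invariant_eq1]).

    - If p is not 1 on some ray t^2 x0'Ax0 with x0 in S, rescaling by
      c = x0'Ax0 / x0'Bx0 turns q into p. For the other x in S, either
      x'Ax = c x'Bx, or p is constant by the previous fact. Hence A - cB
      vanishes on S, A = cB, and the two functions agree everywhere. If there
      is no such x0, both functions are constantly 1 ([quadf_transfer]).

    There remains the uniqueness theorem for characteristic functions
    ([charfun_inj]), proved here by a monotone class argument rather than by
    Fourier inversion. Call f a multiplier if, for every bounded g for which
    g P and g Q have the same Fourier transform, f g has this property too.
    Multipliers are closed under sums, products and bounded pointwise limits,
    and x |-> sin(x.eta) is one of them. The sets whose indicator is a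
    multiplier form a sigma-algebra for which every multiplier is measurable
    ([limalg_measurable_fun]); as n sin(x_i / n) tends to x_i, the coordinates
    are measurable for it, so it contains the Borel sets. When the
    characteristic functions agree, g = 1 is admissible and P B = Q B. *)

(** * Function algebras closed under bounded limits *)

Record limit_algebra {R : realType} {T : Type} (N : set (T -> R)) : Prop :=
  LimitAlgebra {
    limalg_bounded : forall f, N f -> exists C : R, forall x, `|f x| <= C ;
    limalg_cst : forall c : R, N (fun=> c) ;
    limalg_add : forall f g, N f -> N g -> N (fun x => f x + g x) ;
    limalg_mul : forall f g, N f -> N g -> N (fun x => f x * g x) ;
    limalg_lim : forall (f_ : nat -> T -> R) (f : T -> R) (C : R),
      (forall n, N (f_ n)) -> (forall n x, `|f_ n x| <= C) ->
      (forall x, f_ n x @[n --> \oo] --> f x) -> N f }.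

(** The functions t |-> exp(- k exp(- k^2 t)) approximate the indicator of
    t > 0 within [0, 1], and are built from t by ring operations and
    exponentials only. The outer factor k makes the limit 0 at t = 0; the
    square in the inner exponent keeps the limit 1 for t > 0. *)
Lemma exp_tower_lt {R : realType} (t : R) (k : nat) : t <= 0 ->
  expR (- (k.+1%:R * expR (- (k.+1%:R ^+ 2 * t)))) <= k.+1%:R^-1.
Proof.
move=> t0.
have k0 : 0 < k.+1%:R :> R by rewrite ltr0n.
rewrite expRN lef_pV2 ?posrE ?expR_gt0//.
apply: le_trans (expR_ge1Dx _); rewrite -[leLHS]add0r lerD//.
apply: ler_peMr; rewrite ?(ltW k0)// -[leLHS]expR0 ler_expR oppr_ge0 mulr_ge0_le0//.

Qed.

Lemma exp_tower_gt {R : realType} (t : R) (k : nat) : 0 < t ->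
  1 - t^-1 * k.+1%:R^-1 <=
  expR (- (k.+1%:R * expR (- (k.+1%:R ^+ 2 * t)))) <= 1.
Proof.
move=> t0.
have k0 : 0 < k.+1%:R :> R by rewrite ltr0n.
apply/andP; split; last first.
  by rewrite -[leRHS]expR0 ler_expR oppr_le0 mulr_ge0// ?ltW// expR_gt0.
apply: le_trans (expR_ge1Dx _); rewrite lerD2l lerN2.
have kt : 0 < k.+1%:R ^+ 2 * t by rewrite mulr_gt0// exprn_gt0.
have -> : t^-1 * k.+1%:R^-1 = k.+1%:R * (k.+1%:R ^+ 2 * t)^-1.
  by field; rewrite !gt_eqF.
rewrite ler_pM2l// expRN lef_pV2 ?posrE ?expR_gt0//.
by apply: le_trans (expR_ge1Dx _); rewrite -[leLHS]add0r lerD.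
Qed.

Lemma cvg_inv_succ {R : realType} : (n.+1%:R : R)^-1 @[n --> \oo] --> (0 : R).
Proof. exact: cvg_harmonic. Qed.

Lemma cvg_exp_tower {R : realType} (t : R) :
  expR (- (k.+1%:R * expR (- (k.+1%:R ^+ 2 * t)))) @[k --> \oo] -->
  (if 0 < t then 1 else 0 : R).
Proof.
case: ltP => t0.
- apply: (@squeeze_cvgr _ _ _ _ (fun k => 1 - t^-1 * k.+1%:R^-1) (cst 1)).
  + by near=> k; apply: exp_tower_gt.
  + rewrite -[X in _ --> X]subr0 -[X in _ - X](mulr0 t^-1).
    apply: cvgB; first exact: cvg_cst.
    by apply: cvgMl_tmp; exact: cvg_inv_succ.
  + exact: cvg_cst.
- apply: (@squeeze_cvgr _ _ _ _ (cst 0) (fun k => k.+1%:R^-1)).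
  + by near=> k; rewrite expR_ge0/= exp_tower_lt.
  + exact: cvg_cst.
  + exact: cvg_inv_succ.
Unshelve. all: by end_near. Qed.

Lemma norm_series_exp_le {R : realType} (x : R) (n : nat) :
  `|series (exp_coeff x) n| <= expR `|x|.
Proof.
apply: (@le_trans _ _ (series (exp_coeff `|x|) n)).
  rewrite /series/=; apply: le_trans (ler_norm_sum _ _ _) _.
  apply: ler_sum => i _; rewrite /exp_coeff/= normrM normrX ler_wpM2l//.
  by rewrite ger0_norm// invr_ge0 ler0n.
apply: nondecreasing_cvgn_le; last exact: is_cvg_series_exp_coeff.
apply/nondecreasing_seqP => m; rewrite /series/= big_nat_recr//= lerDl.
by rewrite /exp_coeff/= mulr_ge0// ?exprn_ge0// invr_ge0 ler0n.
Qed.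

Section limit_algebra_theory.
Context {R : realType} {T : Type} (N : set (T -> R)) (NA : limit_algebra N).
Implicit Types f g : T -> R.

Lemma limalg_scale (c : R) f : N f -> N (fun x => c * f x).
Proof. exact: (limalg_mul NA) (limalg_cst NA c). Qed.

Lemma limalg_opp f : N f -> N (fun x => - f x).
Proof.
move=> /(limalg_scale (-1)); congr N.
by apply/funext => x; rewrite mulN1r.
Qed.

Lemma limalg_series_exp f n : N f -> N (fun x => series (exp_coeff (f x)) n).
Proof.
move=> Nf; elim: n => [|n IH].
  have -> : (fun x => series (exp_coeff (f x)) 0) = (fun=> 0).
    by apply/funext => x; rewrite /series/= big_geq.
  exact: limalg_cst.
have -> : (fun x => series (exp_coeff (f x)) n.+1) =
    (fun x => series (exp_coeff (f x)) n + f x ^+ n * n`!%:R^-1).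
  by apply/funext => x; rewrite /series/= big_nat_recr.
apply: (limalg_add NA) => //; apply: (limalg_mul NA); last exact: limalg_cst.
elim: n {IH} => [|n IH].
  by have := limalg_cst NA 1; congr N; apply/funext => x; rewrite expr0.
have -> : (fun x => f x ^+ n.+1) = (fun x => f x * f x ^+ n).
  by apply/funext => x; rewrite exprS.
exact: (limalg_mul NA).
Qed.

(** The partial sums of the exponential series are polynomials in f, and all
    of them are bounded by exp(sup |f|). *)
Lemma limalg_expR f : N f -> N (fun x => expR (f x)).
Proof.
move=> Nf; have [C fC] := limalg_bounded NA Nf.
apply: (limalg_lim NA (fun n => limalg_series_exp n Nf) (C := expR C)).
  by move=> n x; apply: le_trans (norm_series_exp_le _ _) _; rewrite ler_expR.
by move=> x; exact: is_cvg_series_exp_coeff.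
Qed.

(** The indicator is the limit of the exponential towers of f - a, which are
    bounded by 1. *)
Lemma limalg_indic_gt f (a : R) : N f -> N \1_[set x | a < f x].
Proof.
move=> Nf.
pose h (k : nat) x :=
  expR (- (k.+1%:R * expR (- (k.+1%:R ^+ 2 * (f x + - a))))).
apply: (@limalg_lim _ _ _ NA h _ 1).
- move=> k; apply: limalg_expR; apply: limalg_opp; apply: limalg_scale.
  apply: limalg_expR; apply: limalg_opp; apply: limalg_scale.
  by apply: (limalg_add NA) => //; exact: limalg_cst.
- move=> k x; rewrite ger0_norm ?expR_ge0// -[leRHS]expR0 ler_expR oppr_le0.
  by rewrite mulr_ge0// expR_ge0.
- move=> x; rewrite indicE (_ : (x \in _) = (a < f x)); last first.
    by apply/idP/idP; rewrite inE.
  by have := @cvg_exp_tower R (f x - a); rewrite subr_gt0; case: ifP.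
Qed.

Definition limalg_events : set (set T) := [set B | N \1_B].

(** Intersections of events correspond to products of indicators, increasing
    unions to bounded limits. *)
Lemma limalg_events_sigma_algebra : sigma_algebra setT limalg_events.
Proof.
apply/sigma_algebraP => //; split.
- rewrite /limalg_events/=; have := limalg_cst NA 1; congr N.
  by apply/funext => x; rewrite indicE in_setT.
- move=> A B BA NA' NB; rewrite /limalg_events/=.
  have := limalg_add NA NA' (limalg_opp NB); congr N; apply/funext => x.
  rewrite !indicE in_setD; case: (boolP (x \in B)) => [xB|xB].
    by rewrite (_ : x \in A) ?subrr// inE; apply: BA; rewrite inE in xB.
  by rewrite andbT subr0.
- move=> F ndF NF; apply: (limalg_lim NA NF (C := 1)).
    by move=> n x; rewrite indicE ger0_norm// lern1 leq_b1.
  move=> x; apply: cvg_near_cst; rewrite !indicE.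
  have [[n _ Fnx]|nF] := pselect ((\bigcup_n F n) x).
    exists n => // m /= nm; rewrite !indicE !mem_set//; first by exists n.
    by have /subsetPset := ndF _ _ nm; apply.
  by near=> m; rewrite !indicE !memNset// => Fmx; apply: nF; exists m.
- move=> A B NA' NB; rewrite /limalg_events/= indicI.
  exact: (limalg_mul NA).
Unshelve. all: by end_near. Qed.

End limit_algebra_theory.

Lemma limalg_measurable_fun {R : realType} {T : pointedType}
    {N : set (T -> R)} (NA : limit_algebra N) (f : T -> R) : N f ->
  measurable_fun setT (f : g_sigma_algebraType (limalg_events N) -> R).
Proof.
move=> Nf; apply: (measurability _ (RGenOInfty.measurableE R)).
move=> _ [_ [a ->] <-]; apply: sub_sigma_algebra; rewrite setTI.
rewrite /limalg_events/=; have := limalg_indic_gt NA a Nf; congr (N \1__).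
by apply/seteqP; split => x; rewrite /= in_itv/= andbT.
Qed.

Lemma limalg_eventsP {R : realType} {T : pointedType}
    {N : set (T -> R)} (NA : limit_algebra N)
    (B : set (g_sigma_algebraType (limalg_events N))) :
  measurable B -> N \1_B.
Proof.
move=> mB; apply: (smallest_sub (limalg_events_sigma_algebra NA) _ mB) => //.
Qed.

(** * Multipliers of a space of bounded measurable functions *)

Definition bounded_mfun {R : realType} {d : measure_display}
    {T : measurableType d} : set (T -> R) :=
  [set f : T -> R | measurable_fun setT f /\ exists C : R, forall x, `|f x| <= C].

Record limit_space {R : realType} {d : measure_display} {T : measurableType d}
  (L : set (T -> R)) : Prop := LimitSpace {
    limsp_bmfun : L `<=` bounded_mfun ;
    limsp_scale : forall (c : R) f, L f -> L (fun x => c * f x) ;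
    limsp_add : forall f g, L f -> L g -> L (fun x => f x + g x) ;
    limsp_lim : forall (f_ : nat -> T -> R) (f : T -> R) (C : R),
      (forall n, L (f_ n)) -> (forall n x, `|f_ n x| <= C) ->
      (forall x, f_ n x @[n --> \oo] --> f x) -> L f }.

(** A limit space of functions, such as those with the same mean under two
    measures, is in general not stable under products. Its multipliers are,
    and this is what turns a linear condition into an algebra. *)
Definition multipliers {R : realType} {d : measure_display}
    {T : measurableType d} (L : set (T -> R)) : set (T -> R) :=
  [set f | bounded_mfun f /\ forall g, L g -> L (fun x => f x * g x)].

Section bounded_measurable.
Context {R : realType} {d : measure_display} {T : measurableType d}.
Implicit Types f g : T -> R.

Lemma bounded_mfun_cst (c : R) : bounded_mfun (fun _ : T => c).
Proof. by split; [exact: measurable_cst|exists `|c|]. Qed.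

Lemma bounded_mfunD f g : bounded_mfun f -> bounded_mfun g ->
  bounded_mfun (fun x => f x + g x).
Proof.
move=> [mf [C fC]] [mg [D gD]]; split; first exact: measurable_funD.
by exists (C + D) => x; rewrite (le_trans (ler_normD _ _))// lerD.
Qed.

Lemma bounded_mfunM f g : bounded_mfun f -> bounded_mfun g ->
  bounded_mfun (fun x => f x * g x).
Proof.
move=> [mf [C fC]] [mg [D gD]]; split; first exact: measurable_funM.
by exists (C * D) => x; rewrite normrM ler_pM.
Qed.

Lemma bounded_mfun_lim (f_ : nat -> T -> R) f (C : R) :
  (forall n, bounded_mfun (f_ n)) -> (forall n x, `|f_ n x| <= C) ->
  (forall x, f_ n x @[n --> \oo] --> f x) -> bounded_mfun f.
Proof.
move=> mf fC ff; split.
  by apply: (@measurable_fun_cvg _ _ _ setT f_) => // n; have [] := mf n.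
exists C => x; apply: (cvgr_to_le (cvg_norm (ff x))).
by near=> n; exact: fC.
Unshelve. all: by end_near. Qed.

Lemma multipliers_limit_algebra (L : set (T -> R)) :
  limit_space L -> limit_algebra (multipliers L).
Proof.
move=> LS; split.
- by move=> f [[_]].
- move=> c; split; first exact: bounded_mfun_cst.
  by move=> g; exact: limsp_scale.
- move=> f g [bf Lf] [bg Lg]; split; first exact: bounded_mfunD.
  move=> h Lh; have := limsp_add LS (Lf _ Lh) (Lg _ Lh); congr L.
  by apply/funext => x; rewrite mulrDl.
- move=> f g [bf Lf] [bg Lg]; split; first exact: bounded_mfunM.
  move=> h Lh; have := Lf _ (Lg _ Lh); congr L.
  by apply/funext => x; rewrite mulrA.
- move=> f_ f C Lf fC ff; split.
    by apply: bounded_mfun_lim fC ff => n; have [] := Lf n.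
  move=> g Lg; have [_ [D gD]] := limsp_bmfun LS Lg.
  apply: (@limsp_lim _ _ _ _ LS (fun n x => f_ n x * g x) _ (C * D)).
  + by move=> n; apply: (Lf n).2.
  + by move=> n x; rewrite normrM ler_pM.
  + by move=> x; apply: cvgMr_tmp; exact: ff.
Qed.

Lemma integrable_bounded_mfun (mu : {finite_measure set T -> \bar R}) f :
  bounded_mfun f ->
  mu.-integrable setT (EFin \o f).
Proof.
move=> [mf [C fC]]; apply: measurable_bounded_integrable => //.
  by rewrite ltey_eq fin_num_measure.
exists C; split; first exact: num_real.
by move=> M CM x _ /=; exact: le_trans (fC x) (ltW CM).
Qed.

Variables P Q : probability T R.

Definition same_mean : set (T -> R) :=
  [set f | bounded_mfun f /\ \int[P]_x f x = \int[Q]_x f x].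

(** Stability under bounded limits is the dominated convergence theorem. *)
Lemma same_mean_limit_space : limit_space same_mean.
Proof.
split; first by move=> f [].
- move=> c f [bf PQf]; split.
    by apply: bounded_mfunM => //; exact: bounded_mfun_cst.
  by rewrite !RintegralZl ?PQf//; exact: integrable_bounded_mfun.
- move=> f g [bf PQf] [bg PQg]; split; first exact: bounded_mfunD.
  by rewrite !RintegralD ?PQf ?PQg//; exact: integrable_bounded_mfun.
- move=> f_ f C Lf fC ff; split.
    by apply: bounded_mfun_lim fC ff => n; have [] := Lf n.
  have dom (mu : probability T R) :
      (\int[mu]_x (f_ n x)%:E @[n --> \oo] --> \int[mu]_x (f x)%:E)%E.
    apply: (@dominated_cvg _ _ _ mu setT measurableT _ _ (fun=> C%:E)) => //.
    + by move=> n; apply/measurable_EFinP; have [[]] := Lf n.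
    + move=> x _; apply: cvg_EFin; last exact: ff.
      by near=> n.
    + apply: integrable_bounded_mfun; exact: bounded_mfun_cst.
    + by move=> n x _; rewrite abse_EFin lee_fin.
  have PQ_ : (fun n => \int[P]_x (f_ n x)%:E)%E = (fun n => \int[Q]_x (f_ n x)%:E)%E.
    apply/funext => n; have [bf PQf] := Lf n.
    have := congr1 (@EFin R) PQf; rewrite /Rintegral.
    by rewrite !fineK//; apply: integrable_fin_num => //;
      exact: integrable_bounded_mfun.
  have domP := dom P; rewrite PQ_ in domP.
  by congr fine; exact: cvg_unique domP (dom Q).
Unshelve. all: by end_near. Qed.

End bounded_measurable.

(** * Dot products, coordinates and Borel sets *)

Lemma dotvDr {R : realType} {d : nat} (x y z : 'cV[R]_d) :
  dotv x (y + z) = dotv x y + dotv x z.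
Proof. by rewrite /dotv mulmxDr mxE. Qed.

Lemma dotvZr {R : realType} {d : nat} (c : R) (x y : 'cV[R]_d) :
  dotv x (c *: y) = c * dotv x y.
Proof. by rewrite /dotv -scalemxAr mxE. Qed.

Lemma dotvNr {R : realType} {d : nat} (x y : 'cV[R]_d) :
  dotv x (- y) = - dotv x y.
Proof. by rewrite -scaleN1r dotvZr mulN1r. Qed.

Lemma dotv0r {R : realType} {d : nat} (x : 'cV[R]_d) : dotv x 0 = 0.
Proof. by rewrite /dotv mulmx0 mxE. Qed.

Lemma dotv_delta {R : realType} {d : nat} (x : 'cV[R]_d) (i : 'I_d) :
  dotv x (delta_mx i 0) = x i 0.
Proof.
rewrite dotvE (bigD1 i)//= big1 => [|j ji]; rewrite mxE eqxx ?(negPf ji) ?mulr0//.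
by rewrite eqxx mulr1 addr0.
Qed.

Lemma continuous_dotv {R : realType} {d : nat} (xi : 'cV[R]_d) :
  continuous (fun x : 'cV[R]_d => dotv x xi).
Proof.
have -> : (fun x : 'cV[R]_d => dotv x xi) = fun x => \sum_i x i 0 * xi i 0.
  by apply/funext => x; rewrite dotvE.
elim: (index_enum _) => [|k r IH].
  under eq_fun do rewrite big_nil.
  exact: cst_continuous.
under eq_fun do rewrite big_cons.
have cX (w : 'cV[R]_d) :
    {for w, continuous (fun w : 'cV[R]_d => w k 0 * xi k 0)}.
  by apply: continuousM; [exact: coord_continuous|exact: cst_continuous].
by move=> w; exact: (continuousD (cX w) (IH w)).
Qed.

Lemma continuous_borelVec {R : realType} {d : nat} (f : 'cV[R]_d -> R) :
  continuous f -> measurable_fun setT (f : borelVec R d -> R).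
Proof.
move=> cf; apply: (measurability _ (RGenOpens.measurableE R)).
move=> _ [_ [a [b ->]] <-]; apply: sub_sigma_algebra; rewrite setTI /=.
by apply: open_comp => [x _|]; [exact: cf|exact: interval_open].
Qed.

(** An open set is the countable union of the rational cubes that it contains,
    and cubes are cut out by finitely many conditions on coordinates. *)
Lemma open_coord_measurable {R : realType} {d : nat}
    (E : set (set 'cV[R]_d)) (U : set (g_sigma_algebraType E)) :
  (forall i, measurable_fun setT
    (fun x : g_sigma_algebraType E => (x : 'cV[R]_d) i 0)) ->
  open (U : set 'cV[R]_d) -> measurable U.
Proof.
move=> mcoord Uo.
pose box (p : 'cV[rat]_d * nat) : set (g_sigma_algebraType E) :=
  [set x | forall i, `|(x : 'cV[R]_d) i 0 - ratr (p.1 i 0)| < p.2.+1%:R^-1].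
have mbox p : measurable (box p).
  have -> : box p = ~` \bigcup_(i : 'I_d)
      [set x | p.2.+1%:R^-1 <= `|(x : 'cV[R]_d) i 0 - ratr (p.1 i 0)|].
    apply/seteqP; split => x /= bx; first by move=> [i _] /=; rewrite leNgt bx.
    by move=> i; rewrite ltNge; apply/negP => xi; apply: bx; exists i.
  apply: measurableC; apply: countable_bigcupT_measurable => // i.
  rewrite -[X in measurable X]setTI.
  apply: (@measurable_fun_ler _ _ _ setT (fun=> _)) => //.
  apply: measurableT_comp => //; apply: measurable_funB => //.
pose F p := if `[< box p `<=` U >] then box p else set0.
have -> : U = \bigcup_p F p.
  apply/seteqP; split => x; last first.
    by move=> [p _]; rewrite /F; case: asboolP => [bU /bU|_ []].
  move=> Ux; have /nbhs_ballP[e /= e0 eU] : nbhs (x : 'cV[R]_d) U.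
    exact: open_nbhs_nbhs.
  have [n _ /(_ n (leqnn n)) /= ne] :=
    near_infty_natSinv_lt (PosNum (divr_gt0 e0 (ltr0n R 2))).
  have n0 : 0 < n.+1%:R^-1 :> R by rewrite invr_gt0 ltr0n.
  have /choice[q qx] : forall i : 'I_d, exists q : rat,
      `|(x : 'cV[R]_d) i 0 - ratr q| < n.+1%:R^-1.
    move=> i; have /rat_in_itvoo[q] :
        (x : 'cV[R]_d) i 0 < (x : 'cV[R]_d) i 0 + n.+1%:R^-1.
      by rewrite ltrDl.
    rewrite in_itv/= => /andP[xq qx]; exists q.
    by rewrite distrC ger0_norm ?subr_ge0 ?(ltW xq)// ltrBlDl.
  (* y and x are both at distance less than 1 / (n + 1) < e / 2 from q. *)
  exists (\col_i q i, n) => //; rewrite /F; case: asboolP => [_ i|[]].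
    by rewrite mxE; exact: qx.
  move=> y yq; apply: eU; split => // i j; rewrite [j]ord1 /ball/=.
  have := yq i; rewrite /= mxE distrC => yq'.
  rewrite -(subrKA (ratr (q i))); apply: le_lt_trans (ler_normD _ _) _.
  by rewrite (splitr e); apply: ltrD;
    [exact: lt_trans (qx i) ne|exact: lt_trans yq' ne].
apply: countable_bigcupT_measurable => [|p]; first exact: countableP.
by rewrite /F; case: asboolP.
Qed.

(** * Uniqueness of the characteristic function *)

(** This is the derivative at 0 of h |-> sin(t h), along h = 1 / (n + 1). *)
Lemma cvg_scaled_sin {R : realType} (t : R) :
  n.+1%:R * sin (t * n.+1%:R^-1) @[n --> \oo] --> t.
Proof.
have dt : is_derive (0 : R) (1 : R) (t \*: id : R -> R) (t *: 1).
  exact: is_deriveZ.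
have := is_derive1_comp (is_derive_sin _) dt.
rewrite /= scaler0 cos0 mul1r [t%:A]mulr1 => -[dsin sin0t].
have /cvg_dnbhs_at_right := dsin; rewrite -/(derive _ _ _) sin0t.
move/cvg_at_rightP => /(_ (fun n => n.+1%:R^-1)) cv.
have /cv : (forall n, 0 < n.+1%:R^-1 :> R) /\ (n.+1%:R : R)^-1 @[n --> \oo] --> 0.
  by split; [move=> n; rewrite invr_gt0 ltr0n|exact: cvg_inv_succ].
apply: cvg_trans; apply: near_eq_cvg; near=> n.
rewrite /= !addr0 scaler0 sin0 subr0 invrK.
by rewrite /GRing.scale/= mulr1.
Unshelve. all: by end_near. Qed.

Section charfun_uniqueness.
Context {R : realType} {d : nat} (P Q : probability (borelVec R d) R).

(** Real form of: the complex measures g P and g Q have the same Fourier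
    transform. *)
Definition same_transform : set (borelVec R d -> R) :=
  [set g | forall xi : 'cV[R]_d,
    same_mean P Q (fun x => g x * cos (dotv x xi)) /\
    same_mean P Q (fun x => g x * sin (dotv x xi))].

Lemma bounded_mfun_cos (xi : 'cV[R]_d) :
  bounded_mfun (fun x : borelVec R d => cos (dotv x xi)).
Proof.
split; last by exists 1 => x; exact: cos_max.
apply: continuous_borelVec => x.
by apply: continuous_comp; [exact: continuous_dotv|exact: continuous_cos].
Qed.

Lemma bounded_mfun_sin (xi : 'cV[R]_d) :
  bounded_mfun (fun x : borelVec R d => sin (dotv x xi)).
Proof.
split; last by exists 1 => x; exact: sin_max.
apply: continuous_borelVec => x.
by apply: continuous_comp; [exact: continuous_dotv|exact: continuous_sin].
Qed.

Lemma same_transform_limit_space : limit_space same_transform.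
Proof.
have [sub scale add lim] := same_mean_limit_space P Q.
split.
- move=> g /(_ 0)[[bg _] _]; move: bg; congr bounded_mfun.
  by apply/funext => x; rewrite dotv0r cos0 mulr1.
- move=> c f Lf xi; have [fc fs] := Lf xi; split.
    by have := scale c _ fc; congr same_mean; apply/funext => x; rewrite mulrA.
  by have := scale c _ fs; congr same_mean; apply/funext => x; rewrite mulrA.
- move=> f g Lf Lg xi; have [fc fs] := Lf xi; have [gc gs] := Lg xi; split.
    by have := add _ _ fc gc; congr same_mean; apply/funext => x; rewrite mulrDl.
  by have := add _ _ fs gs; congr same_mean; apply/funext => x; rewrite mulrDl.
- move=> f_ f C Lf fC ff xi; split.
    apply: (lim (fun n x => f_ n x * cos (dotv x xi)) _ C).
    + by move=> n; have [] := Lf n xi.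
    + by move=> n x; rewrite normrM -[leRHS]mulr1 ler_pM// cos_max.
    + by move=> x; apply: cvgMr_tmp; exact: ff.
  apply: (lim (fun n x => f_ n x * sin (dotv x xi)) _ C).
  + by move=> n; have [] := Lf n xi.
  + by move=> n x; rewrite normrM -[leRHS]mulr1 ler_pM// sin_max.
  + by move=> x; apply: cvgMr_tmp; exact: ff.
Qed.

Let N := multipliers same_transform.
Let NA : limit_algebra N := multipliers_limit_algebra same_transform_limit_space.

(** Multiplying g by sin(x.eta) replaces its transform by a combination of
    translates by eta and minus eta. *)
Lemma multipliers_sin (eta : 'cV[R]_d) : N (fun x => sin (dotv x eta)).
Proof.
split; first exact: bounded_mfun_sin.
have [sub scale add lim] := same_mean_limit_space P Q.
move=> g Lg xi; have [pc ps] := Lg (xi + eta); have [mc ms] := Lg (xi - eta).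
split.
- have := scale 2^-1 _ (add _ _ ps (scale (-1) _ ms)).
  congr same_mean; apply/funext => x; rewrite !dotvDr dotvNr sinB sinD.
  by field.
- have := scale 2^-1 _ (add _ _ mc (scale (-1) _ pc)).
  congr same_mean; apply/funext => x; rewrite !dotvDr dotvNr cosB cosD.
  by field.
Qed.

Lemma multipliers_coord_measurable (i : 'I_d) :
  measurable_fun setT
    (fun x : g_sigma_algebraType (limalg_events N) => (x : 'cV[R]_d) i 0).
Proof.
apply: (@measurable_fun_cvg _ _ _ setT
  (fun n (x : g_sigma_algebraType (limalg_events N)) =>
     n.+1%:R * sin (dotv x (n.+1%:R^-1 *: delta_mx i 0)))) => [n|x _].
  apply: (limalg_measurable_fun NA); apply: (limalg_scale NA).
  exact: multipliers_sin.
under eq_fun do rewrite dotvZr dotv_delta mulrC [_^-1 * _]mulrC mulrC.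
exact: cvg_scaled_sin.
Qed.

Lemma charfun_inj : (forall xi, charfun P xi = charfun Q xi) ->
  forall B, measurable B -> P B = Q B.
Proof.
move=> PQ B mB.
have one_test : same_transform (fun=> 1).
  move=> xi; have [c s] := PQ xi.
  split; split.
  - by apply: bounded_mfunM; [exact: bounded_mfun_cst|exact: bounded_mfun_cos].
  - by under eq_Rintegral do rewrite mul1r; under [RHS]eq_Rintegral do rewrite mul1r.
  - by apply: bounded_mfunM; [exact: bounded_mfun_cst|exact: bounded_mfun_sin].
  - by under eq_Rintegral do rewrite mul1r; under [RHS]eq_Rintegral do rewrite mul1r.
have NB : N \1_B.
  apply: (limalg_eventsP NA); apply: (smallest_sub _ _ mB).
    exact: sigma_algebra_measurable.
  move=> U Uo; exact: open_coord_measurable multipliers_coord_measurable Uo.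
have [_ /(_ _ one_test)/(_ 0)[[_ ]]] := NB.
have mean (mu : probability (borelVec R d) R) :
    \int[mu]_x (\1_B x * 1 * cos (dotv x 0)) = fine (mu B).
  under eq_Rintegral do rewrite dotv0r cos0 !mulr1.
  by rewrite /Rintegral integral_indic// setIT.
rewrite !mean => /(congr1 (@EFin R)); rewrite !fineK//; exact: fin_num_measure.
Qed.

End charfun_uniqueness.

(** * Projections on subspaces *)

Lemma dotvC {R : realType} {d : nat} (x y : 'cV[R]_d) : dotv x y = dotv y x.
Proof. by rewrite !dotvE; apply: eq_bigr => i _; rewrite mulrC. Qed.

Lemma dotv_orth_proj {R : realType} {d : nat} (H : {vspace 'cV[R]_d})
    (y h : 'cV[R]_d) : h \in H -> dotv y h = dotv (vsval (orth_proj H y)) h.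
Proof.
move=> hH; have := @orth_projP R d H y h hH.
by rewrite dotvDr dotvNr => /eqP; rewrite subr_eq0 !(dotvC h) => /eqP.
Qed.

Lemma continuous_borelSubspace {R : realType} {d : nat}
    (H : {vspace 'cV[R]_d}) (f : 'cV[R]_d -> R) :
  continuous f -> measurable_fun setT (fun u : borelSubspace H => f (vsval u)).
Proof.
move=> cf; apply: (measurability _ (RGenOpens.measurableE R)).
move=> _ [_ [a [b ->]] <-]; apply: sub_sigma_algebra; rewrite setTI /=.
exists (f @^-1` `]a, b[%classic) => //.
by apply: open_comp => [x _|]; [exact: cf|exact: interval_open].
Qed.

Lemma Rintegral_proj_prob {R : realType} {d : nat}
    (P : probability (borelVec R d) R) (H : {vspace 'cV[R]_d})
    (h : 'cV[R]_d) (g : R -> R) (C : R) :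
  h \in H -> continuous g -> (forall s, `|g s| <= C) ->
  \int[P]_y g (dotv y h) = \int[proj_prob P H]_u g (dotv (vsval u) h).
Proof.
move=> hH cg gC; rewrite /Rintegral; congr fine.
have cgd : continuous (fun y : 'cV[R]_d => g (dotv y h)).
  by move=> y; apply: continuous_comp; [exact: continuous_dotv|exact: cg].
have E : (fun y : borelVec R d => (g (dotv y h))%:E) =
    (fun u : borelSubspace H => (g (dotv (vsval u) h))%:E) \o orth_proj H.
  by apply/funext => y /=; rewrite -dotv_orth_proj.
rewrite /proj_prob integral_distribution.
- by rewrite -E.
- by apply/measurable_EFinP; exact: continuous_borelSubspace cgd.
- rewrite -E; apply: integrable_bounded_mfun; split; last by exists C.
  exact: continuous_borelVec.
Qed.

Lemma charfun_proj_prob {R : realType} {d : nat}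
    (P Q : probability (borelVec R d) R) (H : {vspace 'cV[R]_d}) (h : 'cV[R]_d) :
  (forall B : set (borelSubspace H), measurable B ->
     proj_prob P H B = proj_prob Q H B) ->
  h \in H -> charfun P h = charfun Q h.
Proof.
move=> PQ hH; rewrite /charfun /Cintegral /=; congr Complex.
- rewrite !(Rintegral_proj_prob _ hH (@continuous_cos R) (@cos_max R)).
  by congr fine; apply: eq_measure_integral => A mA _; exact: PQ.
- rewrite !(Rintegral_proj_prob _ hH (@continuous_sin R) (@sin_max R)).
  by congr fine; apply: eq_measure_integral => A mA _; exact: PQ.
Qed.

(** * Real profiles of elliptical distributions *)

Lemma charfunN {R : realType} {d : nat} (P : probability (borelVec R d) R)
    (xi : 'cV[R]_d) :
  charfun P (- xi) =
  Complex (complex.Re (charfun P xi)) (- complex.Im (charfun P xi)).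
Proof.
rewrite /charfun /Cintegral /=; congr Complex.
  by apply: eq_Rintegral => x _; rewrite dotvNr cosN.
rewrite -mulN1r -RintegralZl//; last first.
  exact: (integrable_bounded_mfun _ (bounded_mfun_sin xi)).
by apply: eq_Rintegral => x _; rewrite dotvNr sinN mulN1r.
Qed.

Lemma charfun0 {R : realType} {d : nat} (P : probability (borelVec R d) R) :
  charfun P 0 = 1.
Proof.
rewrite /charfun /Cintegral /=.
under eq_Rintegral do rewrite dotv0r cos0.
under [X in Complex _ X]eq_Rintegral do rewrite dotv0r sin0.
rewrite !Rintegral_cst// mul0r mul1r.
by rewrite [X in fine X](@probability_setT _ _ _ P).
Qed.

Lemma quadf0 {R : realType} {d : nat} (A : 'M[R]_d) : quadf A 0 = 0.
Proof. by rewrite /quadf mulmx0 mxE. Qed.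

Lemma quadfZ {R : realType} {d : nat} (A : 'M[R]_d) (t : R) (x : 'cV[R]_d) :
  quadf A (t *: x) = t ^+ 2 * quadf A x.
Proof.
have -> : quadf A (t *: x) = ((t *: x^T) *m A *m (t *: x)) 0 0.
  by rewrite /quadf [(t *: x)^T]linearZ.
by rewrite -scalemxAr -!scalemxAl scalerA mxE expr2.
Qed.

Lemma quadfN {R : realType} {d : nat} (A : 'M[R]_d) (x : 'cV[R]_d) :
  quadf A (- x) = quadf A x.
Proof. by rewrite -scaleN1r quadfZ sqrrN expr1n mul1r. Qed.

(** Convergence to 1 at 0 from the right, the value at 0 included. *)
Definition to1_at0 {R : realType} (p : R -> R) : Prop :=
  forall e : R, 0 < e -> exists2 delta : R, 0 < delta &
    forall s, 0 <= s < delta -> `|p s - 1| < e.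

(** The location can be kept while the profile becomes real: if the profile
    takes the value u + iv at xi'Sigma xi, comparing the characteristic
    function at xi and minus xi gives v cos(mu.xi) = v sin(mu.xi) = 0. *)
Lemma elliptical_real {R : realType} {d : nat}
    (P : probability (borelVec R d) R) : elliptical P ->
  exists (mu : 'cV[R]_d) (Sigma : 'M[R]_d) (p : R -> R),
    [/\ is_psd Sigma, p 0 = 1, to1_at0 p &
        forall xi, charfun P xi =
          Complex (cos (dotv mu xi) * p (quadf Sigma xi))
                  (sin (dotv mu xi) * p (quadf Sigma xi))].
Proof.
move=> [mu [Sigma [psi [psdS cpsi PE]]]].
have psi0 : psi 0 = 1.
  have := PE 0; rewrite charfun0 dotv0r quadf0 /cexpi cos0 sin0.
  by rewrite -[Complex 1 0]/(1 : R[i]) mul1r.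
exists mu, Sigma, (fun s => complex.Re (psi s)); split => //.
- by rewrite psi0.
- move=> e e0; move/subspace_continuousP : cpsi => /(_ 0).
  rewrite /= in_itv/= lexx => /(_ isT)/cvgrPdist_lt/(_ (e%:C)%C).
  rewrite ltcR => /(_ e0)/nbhs_ballP[delta /= delta0 H].
  exists delta => // s /andP[s0 sd].
  have := H s; rewrite /ball/= sub0r normrN ger0_norm// => /(_ sd).
  rewrite in_itv/= s0 => /(_ isT); rewrite /from_subspace psi0 => ps.
  have := le_lt_trans (normc_ge_Re (1 - psi s)) ps.
  by rewrite ltcR raddfB/= distrC.
- move=> xi; have := PE xi; have := PE (- xi).
  rewrite charfunN dotvNr quadfN; case: (psi (quadf Sigma xi)) => u v.
  move=> + E; rewrite E.
  rewrite /cexpi cosN sinN; set c := cos _; set s := sin _.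
  move=> [/= E1 E2].
  have v0 : v = 0.
    have := cos2Dsin2 (dotv mu xi); rewrite -/c -/s => cs.
    have vs : v * s = 0 by lra.
    have vc : v * c = 0 by lra.
    have : v * (c ^+ 2 + s ^+ 2) = 0 by rewrite mulrDr !expr2 !mulrA vs vc; ring.
    by rewrite cs mulr1.
  rewrite v0; congr Complex; rewrite ?mulr0 ?subr0 ?add0r//.
Qed.

(** * Comparison of locations, matrices and profiles *)

(** p(u) = p(u (a/b)^n) for all n, and the argument tends to 0. *)
Lemma scaling_invariant_eq1 {R : realType} (p : R -> R) (a b : R) :
  to1_at0 p -> 0 <= a < b -> (forall s, 0 <= s -> p (s * a) = p (s * b)) ->
  forall u, 0 <= u -> p u = 1.
Proof.
move=> p1 /andP[a0 ab] pab u u0.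
have b0 : 0 < b := le_lt_trans a0 ab.
have lam0 : 0 <= a / b by rewrite divr_ge0// ltW.
have lam1 : `|a / b| < 1 by rewrite ger0_norm// ltr_pdivrMr// mul1r.
have pu n : p (u * (a / b) ^+ n) = p u.
  elim: n => [|n IH]; first by rewrite expr0 mulr1.
  rewrite -{}IH exprSr [u * _]mulrA; set w := u * (a / b) ^+ n.
  have w0 : 0 <= w by rewrite mulr_ge0// exprn_ge0.
  have := pab (w / b); rewrite divr_ge0 ?(ltW b0)// => /(_ isT).
  rewrite divfK ?gt_eqF// => <-. by rewrite mulrA mulrAC.
apply/eqP; apply: contraT => pu1.
have e0 : 0 < `|p u - 1| by rewrite normr_gt0 subr_eq0.
have [delta delta0 pd] := p1 _ e0.
have /cvgrPdist_lt/(_ _ delta0)[n _ /(_ n (leqnn n))] := cvg_geometric u lam1.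
rewrite /geometric/= sub0r normrN => un.
have w0 : 0 <= u * (a / b) ^+ n by rewrite mulr_ge0// exprn_ge0.
have := pd (u * (a / b) ^+ n); rewrite w0 pu ltxx => -> //.
by rewrite -[ltLHS]ger0_norm.
Qed.

(** For small t > 0 the factor p does not vanish, while 0 < t |c| < pi unless
    c = 0. *)
Lemma phase_eq0 {R : realType} (p : R -> R) (a c : R) :
  to1_at0 p -> 0 <= a ->
  (forall t, sin (t * c) * p (t ^+ 2 * a) = 0) -> c = 0.
Proof.
move=> p1 a0 sp; have [delta delta0 pd] := p1 1 ltr01.
apply/eqP; apply: contraT => c0.
have nc0 : 0 < `|c| by rewrite normr_gt0.
have a1 : 0 < a + 1 by rewrite ltr_wpDl.
near (0 : R)^'+ => t.
have t0 : 0 < t by [].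
have t1 : t < 1 by near: t; exact: nbhs_right_lt.
have ta : t * (a + 1) < delta.
  rewrite -ltr_pdivlMr//; near: t; apply: nbhs_right_lt.
  by rewrite divr_gt0.
have tc : t * `|c| < pi.
  rewrite -ltr_pdivlMr//; near: t; apply: nbhs_right_lt.
  by rewrite divr_gt0// pi_gt0.
have p0 : p (t ^+ 2 * a) != 0.
  have := pd (t ^+ 2 * a); rewrite mulr_ge0// ?exprn_ge0 ?(ltW t0)//=.
  have -> : t ^+ 2 * a < delta by nra.
  by move=> /(_ isT); apply: contraTneq => ->; rewrite sub0r normrN normr1 ltxx.
have sc : sin (t * `|c|) = 0.
  have /eqP := sp t; rewrite mulf_eq0 (negPf p0) orbF => /eqP stc.
  by case: (ger0P c) => _ //; rewrite mulrN sinN stc oppr0.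
by have := @sin_gt0_pi R (t * `|c|); rewrite sc ltxx mulr_gt0//= tc => /(_ isT).
Unshelve. all: by end_near. Qed.

Lemma psd_quadf_ge0 {R : realType} {d : nat} (A : 'M[R]_d) (x : 'cV[R]_d) :
  is_psd A -> 0 <= quadf A x.
Proof. by case. Qed.

Lemma quadf_ext {R : realType} {d : nat} (S : set 'cV[R]_d) (A B : 'M[R]_d) :
  sm_uniqueness_set S -> A^T = A -> B^T = B ->
  (forall x, S x -> quadf A x = quadf B x) -> A = B.
Proof.
move=> hS At Bt AB; apply/eqP; rewrite -subr_eq0; apply/eqP; apply: hS.
  by rewrite linearB/= At Bt.
move=> x Sx; have := AB _ Sx; rewrite /quadf mulmxBr mulmxBl !mxE => ->.
by rewrite subrr.
Qed.

(** The quadratic form of (v - w)(v - w)' is the square of the linear form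
    x |-> (v - w).x. *)
Lemma dotv_ext {R : realType} {d : nat} (S : set 'cV[R]_d) (v w : 'cV[R]_d) :
  sm_uniqueness_set S -> (forall x, S x -> dotv v x = dotv w x) -> v = w.
Proof.
move=> hS vw; apply/eqP; rewrite -subr_eq0; apply/eqP.
have vv : (v - w) *m (v - w)^T = 0.
  apply: hS; first by rewrite trmx_mul trmxK.
  move=> x Sx; rewrite /quadf mulmxA -mulmxA mxE big_ord1.
  have -> : ((v - w)^T *m x) 0 0 = 0.
    by rewrite -/(dotv _ _) dotvC dotvDr dotvNr !(dotvC x) vw// subrr.
  by rewrite mulr0.
apply: dotv_self_eq0; rewrite dotvE big1// => i _.
by have := congr1 (fun M : 'M[R]_d => M i i) vv; rewrite mxE big_ord1 !mxE.
Qed.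

(** Either the quadratic form is positive at some point of S, and the values
    of p along that direction are all its values, or the matrix is 0. *)
Lemma quadf_const_ext {R : realType} {d : nat} (S : set 'cV[R]_d)
    (A : 'M[R]_d) (p : R -> R) :
  sm_uniqueness_set S -> is_psd A -> p 0 = 1 ->
  (forall x s, S x -> 0 <= s -> p (s * quadf A x) = 1) ->
  forall xi, p (quadf A xi) = 1.
Proof.
move=> hS psdA p0 pS xi.
have [[x [Sx /eqP Ax]]|noS] := pselect (exists x, S x /\ quadf A x <> 0).
  have := pS x (quadf A xi / quadf A x) Sx; rewrite divfK//; apply.
  by rewrite divr_ge0// psd_quadf_ge0.
have -> : A = 0.
  apply: hS psdA.1 _ => x Sx; apply: contrapT => Ax; apply: noS.
  by exists x.
by rewrite /quadf mulmx0 mul0mx mxE.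
Qed.

(** A profile and its matrix are only determined up to the rescaling
    (p(s), A) |-> (p(c s), A / c), and a constant profile does not see the
    matrix at all. The rescaling factor c is read off at one point x0 of S at
    which the profile is not constant. *)
Lemma quadf_transfer {R : realType} {d : nat} (S : set 'cV[R]_d)
    (A B : 'M[R]_d) (p q : R -> R) :
  sm_uniqueness_set S -> is_psd A -> is_psd B ->
  p 0 = 1 -> q 0 = 1 -> to1_at0 p ->
  (forall x s, S x -> 0 <= s -> p (s * quadf A x) = q (s * quadf B x)) ->
  forall xi, p (quadf A xi) = q (quadf B xi).
Proof.
move=> hS psdA psdB p0 q0 p1 pq xi.
have [pS|] := pselect (forall x s, S x -> 0 <= s -> p (s * quadf A x) = 1).
  rewrite (quadf_const_ext hS psdA p0 pS) (quadf_const_ext hS psdB q0)//.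
  by move=> x s Sx s0; rewrite -pq// pS.
move=> /existsNP[x0 /existsNP[s0 /not_implyP[Sx0 /not_implyP[s00 px0]]]].
have A0 : 0 < quadf A x0.
  rewrite lt_neqAle psd_quadf_ge0// andbT eq_sym; apply/eqP => Ax0.
  by apply: px0; rewrite Ax0 mulr0.
have B0 : 0 < quadf B x0.
  rewrite lt_neqAle psd_quadf_ge0// andbT eq_sym; apply/eqP => Bx0.
  by apply: px0; rewrite pq// Bx0 mulr0.
pose c := quadf A x0 / quadf B x0.
have c0 : 0 < c by rewrite divr_gt0.
have qp u : 0 <= u -> q u = p (u * c).
  move=> u0; have := pq x0 (u / quadf B x0) Sx0.
  rewrite divfK ?gt_eqF// divr_ge0 ?(ltW B0)// => /(_ isT) <-.
  by rewrite /c mulrA mulrAC.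
have pAB x s : S x -> 0 <= s -> p (s * quadf A x) = p (s * (c * quadf B x)).
  move=> Sx s1; rewrite pq// qp ?mulr_ge0 ?psd_quadf_ge0//.
  by rewrite -mulrA [c * _]mulrC.
have AcB : A = c *: B.
  apply: (quadf_ext hS psdA.1); first by rewrite linearZ/= psdB.1.
  move=> x Sx; have -> : quadf (c *: B) x = c * quadf B x.
    by rewrite /quadf -scalemxAr -scalemxAl mxE.
  have pne1 : ~ forall u, 0 <= u -> p u = 1.
    by move=> pe; apply: px0; apply: pe; rewrite mulr_ge0// ltW.
  have cB0 : 0 <= c * quadf B x by rewrite mulr_ge0 ?psd_quadf_ge0// ltW.
  apply/eqP; case: ltgtP => // [lt|lt]; exfalso; apply: pne1.
  - apply: (scaling_invariant_eq1 p1 (a := quadf A x) (b := c * quadf B x)).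
      by rewrite psd_quadf_ge0.
    by move=> s s1; exact: pAB.
  - apply: (scaling_invariant_eq1 p1 (a := c * quadf B x) (b := quadf A x)).
      by rewrite cB0.
    by move=> s s1; rewrite pAB.
rewrite qp ?psd_quadf_ge0//; congr p; rewrite {1}AcB.
by rewrite /quadf -scalemxAr -scalemxAl mxE mulrC.
Qed.

Theorem theorem1 (R : realType) (d : nat) (hd : (0 < d)%N)
    (S : set 'cV[R]_d) (hS : sm_uniqueness_set S)
    (P Q : probability (borelVec R d) R)
    (hP : elliptical P) (hQ : elliptical Q)
    (hPQ : forall x : 'cV[R]_d, S x ->
      forall B : set (borelSubspace <[x]>%VS), measurable B ->
        proj_prob P <[x]>%VS B = proj_prob Q <[x]>%VS B) :
  forall B : set (borelVec R d), measurable B -> P B = Q B.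
Proof.
have [mu [A [p [psdA p0 p1 PE]]]] := elliptical_real hP.
have [nu [B [q [psdB q0 q1 QE]]]] := elliptical_real hQ.
have PQ x t : S x ->
    Complex (cos (t * dotv mu x) * p (t ^+ 2 * quadf A x))
            (sin (t * dotv mu x) * p (t ^+ 2 * quadf A x)) =
    Complex (cos (t * dotv nu x) * q (t ^+ 2 * quadf B x))
            (sin (t * dotv nu x) * q (t ^+ 2 * quadf B x)).
  move=> Sx; rewrite -!quadfZ -!dotvZr -PE -QE.
  by apply: charfun_proj_prob (hPQ x Sx) _; rewrite memvZ// memv_line.
have munu : mu = nu.
  apply: (dotv_ext hS) => x Sx; apply/eqP; rewrite -subr_eq0; apply/eqP.
  apply: (phase_eq0 p1 (psd_quadf_ge0 x psdA)) => t.
  have [c s] := PQ x t Sx.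
  rewrite mulrBr sinB mulrBl mulrAC s [X in _ - X]mulrAC c; ring.
apply: charfun_inj => xi; rewrite PE QE munu.
rewrite (quadf_transfer hS psdA psdB p0 q0 p1)// => x s Sx s0.
have [] := PQ x (Num.sqrt s) Sx; rewrite munu sqr_sqrtr//.
set a := cos _; set b := sin _ => Ea Eb.
have ab : a ^+ 2 + b ^+ 2 = 1 by exact: cos2Dsin2.
(* The equations for both parts recombine with weights cos and sin. *)
rewrite -[LHS]mul1r -[RHS]mul1r -ab !mulrDl !expr2 -!mulrA.
by rewrite Ea Eb.
Qed.
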